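(* Assume the following statement (Cherlin Theorem I): if $R$ is a commutative associative nilring such that the componentwise action of $\mathrm{Aut}(R)$ on $R\times R\times R$ has only finitely many orbits, then $R$ is nilpotent; in particular every $\omega$-categorical commutative nilring is nilpotent. Then: (1) For every prime $p$, every $\omega$-categorical associative nilalgebra $A$ over $\mathbb{F}_p$ whose associated Lie algebra $L(A)$ is nilpotent as a Lie algebra is nilpotent as an associative algebra. (2) In particular, if moreover the statement WCLA holds (for all primes $p$ and all integers $n\geq 1$, every $\omega$-categorical $n$-Engel Lie algebra over $\mathbb{F}_p$ is nilpotent), then every $\omega$-categorical associative nilring is nilpotent.
   Context: A structure $M$ is $\omega$-categorical if its first-order theory has a unique countable model up to isomorphism (finite structures are allowed); by the Ryll-Nardzewski theorem, for countable $M$ this is equivalent to: for every $n\in\mathbb{N}$ the componentwise action of $\mathrm{Aut}(M)$ on $M^n$ has only finitely many orbits, and the latter may be taken as the definition. Rings and algebras are viewed as structures with $+$ and multiplication (or Lie bracket). Rings and associative algebras are not assumed unital. A ring or associative algebra is a nilring, resp. nilalgebra, if for each element $x$ there is $k$ with $x^k=0$. It is nilpotent if there is $k$ such that every product of $k$ elements is $0$. For an associative algebra $A$, the associated Lie algebra $L(A)$ has the same underlying vector space and bracket $[x,y]=xy-yx$. A Lie algebra is $n$-Engel if $[x,y,\ldots,y]=0$ ($y$ repeated $n$ times, left-normed bracket: $[x,y,z]=[[x,y],z]$) for all $x,y$. A Lie algebra is nilpotent if its lower central series reaches $0$ after finitely many steps. *)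

(* Defs.v *)
From HB Require Import structures.
From mathcomp Require Import all_boot all_order all_algebra.
From mathcomp Require Import boolp classical_sets functions cardinality.

Set Implicit Arguments.
Unset Strict Implicit.
Unset Printing Implicit Defensive.

Import GRing.Theory.
Local Open Scope ring_scope.
Local Open Scope classical_set_scope.

(* MathComp rings are unital, hence the explicit records. *)
Record assocRing := AssocRing {
  ring_sort :> zmodType;
  ring_mul : ring_sort -> ring_sort -> ring_sort;
  ring_mulA : associative ring_mul;
  ring_mulDl : left_distributive ring_mul +%R;
  ring_mulDr : right_distributive ring_mul +%R }.

Record assocAlg (K : fieldType) := AssocAlg {
  alg_sort :> lmodType K;
  alg_mul : alg_sort -> alg_sort -> alg_sort;
  alg_mulA : associative alg_mul;
  alg_linearl : forall y, linear (alg_mul^~ y);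
  alg_linearr : forall x, linear (alg_mul x) }.

Record lieAlg (K : fieldType) := LieAlg {
  lie_sort :> lmodType K;
  bracket : lie_sort -> lie_sort -> lie_sort;
  bracket_linearl : forall y, linear (bracket^~ y);
  bracket_linearr : forall x, linear (bracket x);
  bracketxx : forall x, bracket x x = 0;
  bracket_jacobi : forall x y z,
    bracket x (bracket y z) + bracket y (bracket z x)
      + bracket z (bracket x y) = 0 }.

Section AssociatedLie.
Variables (K : fieldType) (A : assocAlg K).

Definition commutator (x y : A) : A := alg_mul x y - alg_mul y x.

Lemma alg_mulBl (x y z : A) :
  alg_mul (x - y) z = alg_mul x z - alg_mul y z.
Proof. by rewrite addrC -scaleN1r alg_linearl scaleN1r addrC. Qed.

Lemma alg_mulBr (x y z : A) :
  alg_mul z (x - y) = alg_mul z x - alg_mul z y.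
Proof. by rewrite addrC -scaleN1r alg_linearr scaleN1r addrC. Qed.

Lemma commutator_linearl (y : A) : linear (commutator^~ y).
Proof.
move=> a u v; rewrite /commutator alg_linearl alg_linearr.
by rewrite opprD addrACA scalerBr.
Qed.

Lemma commutator_linearr (x : A) : linear (commutator x).
Proof.
move=> a u v; rewrite /commutator alg_linearl alg_linearr.
by rewrite opprD addrACA scalerBr.
Qed.

Lemma commutatorxx (x : A) : commutator x x = 0.
Proof. exact: subrr. Qed.

Lemma commutator_jacobi (x y z : A) :
  commutator x (commutator y z) + commutator y (commutator z x)
    + commutator z (commutator x y) = 0.
Proof.
have E (a b c : A) : commutator a (commutator b c) =
    (alg_mul (alg_mul a b) c + alg_mul (alg_mul c b) a)
    - (alg_mul (alg_mul a c) b + alg_mul (alg_mul b c) a).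
  by rewrite /commutator alg_mulBl alg_mulBr !alg_mulA opprB addrACA opprD.
rewrite !E [alg_mul (alg_mul y z) x + _]addrC subrKA.
rewrite [alg_mul (alg_mul y x) z + _]addrC subrKA.
by rewrite [alg_mul (alg_mul z y) x + _]addrC subrr.
Qed.

Definition associated_lie : lieAlg K :=
  LieAlg commutator_linearl commutator_linearr commutatorxx commutator_jacobi.

End AssociatedLie.

(* The structure (V, +, op); over 'F_p the scalar multiplication is definable
   from +, so its preservation need not be required of automorphisms. *)
Section Structure.
Variables (V : zmodType) (op : V -> V -> V).

Record automorphism (f : V -> V) : Prop := Automorphism {
  automorphism_bij : bijective f;
  automorphismD : {morph f : x y / x + y};
  automorphismM : {morph f : x y / op x y} }.

Definition aut_orbit n (x : n.-tuple V) : set (n.-tuple V) :=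
  [set map_tuple f x | f in automorphism].

Definition finitely_many_orbits n : Prop := finite_set (range (@aut_orbit n)).

(* The Ryll-Nardzewski form; [countable] includes finite. *)
Definition omega_categorical : Prop :=
  countable [set: V] /\ forall n, finitely_many_orbits n.

(* [iter k (op x) x] is the power x^(k+1). *)
Definition is_nil : Prop := forall x, exists k, iter k (op x) x = 0.

(* [foldl op x s] is the left-normed product of the (size s).+1 elements of
   x :: s; for associative op the bracketing is irrelevant. *)
Definition is_nilpotent : Prop :=
  exists k, forall (x : V) (s : k.-tuple V), foldl op x s = 0.

End Structure.

Section LieNilpotency.
Variables (K : fieldType) (L : lieAlg K).

Definition engel n : Prop :=
  forall x y : L, iter n (fun z => bracket z y) x = 0.

Definition subspace (W : set L) : Prop :=
  W 0 /\ forall a u v, W u -> W v -> W (a *: u + v).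

Fixpoint lower_central n : set L :=
  if n is m.+1 then
    smallest subspace [set bracket x y | x in lower_central m & y in setT]
  else setT.

Definition lie_nilpotent : Prop := exists n, lower_central n = [set 0].

End LieNilpotency.

(* It covers every omega-categorical commutative nilring, triples being the
   case n = 3 of [omega_categorical]. *)
Definition cherlin_theorem_I : Prop :=
  forall R : assocRing, commutative (@ring_mul R) -> is_nil (@ring_mul R) ->
    finitely_many_orbits (@ring_mul R) 3%N -> is_nilpotent (@ring_mul R).

Definition WCLA : Prop :=
  forall p n, prime p -> (1 <= n)%N -> forall L : lieAlg 'F_p,
    omega_categorical (@bracket _ L) -> engel L n -> lie_nilpotent L.

(* Main.v *)
(* If L(A) is nilpotent of class c + 1, the center Z of A (which is also the
   center of L(A)) is a commutative nilring invariant under Aut(A), hence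
   nilpotent by Cherlin's theorem.  As Z is central, the ideal I it generates is
   nilpotent, and L(A / I) has class at most c; (1) follows by induction on c.
   For (2), finiteness of the orbits on pairs and on elements bounds the additive
   exponent n and the nil index of R.  Filtering R by multiples of the primes
   dividing n reduces to F_p-algebras; there a bounded nil index makes L(A) an
   Engel Lie algebra, so WCLA and (1) apply. *)
Require Import Defs.
From HB Require Import structures.
From mathcomp Require Import all_boot all_order all_algebra.
From mathcomp Require Import boolp classical_sets functions cardinality.

Set Implicit Arguments.
Unset Strict Implicit.
Unset Printing Implicit Defensive.

Import GRing.Theory.
Local Open Scope ring_scope.

(** * Automorphisms and their orbits on tuples *)

Section Orbits.
Variables (V : zmodType) (op : V -> V -> V).
Implicit Types f g : V -> V.

Lemma automorphism_id : automorphism op id.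
Proof. by split=> //; exists id. Qed.

Lemma automorphism_comp f g :
  automorphism op f -> automorphism op g -> automorphism op (f \o g).
Proof.
case=> bf Df Mf [bg Dg Mg]; split; first exact: bij_comp.
- by move=> x y /=; rewrite Dg Df.
- by move=> x y /=; rewrite Mg Mf.
Qed.

Lemma automorphism_inv f : automorphism op f ->
  exists g, [/\ automorphism op g, cancel f g & cancel g f].
Proof.
case=> [[g fK gK]] Df Mf; exists g; split=> //; split; first by exists f.
- by move=> x y; apply: (can_inj fK); rewrite Df !gK.
- by move=> x y; apply: (can_inj fK); rewrite Mf !gK.
Qed.

Lemma automorphism0 f : automorphism op f -> f 0 = 0.
Proof. by move=> [_ Df _]; apply: (addIr (f 0)); rewrite -Df !add0r. Qed.

Lemma automorphismN f x : automorphism op f -> f (- x) = - f x.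
Proof.
move=> af; apply: (addIr (f x)).
by rewrite -(automorphismD af) !addNr (automorphism0 af).
Qed.

Lemma automorphismMn f x n : automorphism op f -> f (x *+ n) = f x *+ n.
Proof.
move=> af; elim: n => [|n IH]; first by rewrite !mulr0n (automorphism0 af).
by rewrite !mulrS (automorphismD af) IH.
Qed.

Lemma automorphism_iter f k x : automorphism op f ->
  f (iter k (op x) x) = iter k (op (f x)) (f x).
Proof. by move=> af; elim: k => //= k IH; rewrite (automorphismM af) IH. Qed.

Lemma aut_orbit_eq n (x : n.-tuple V) f :
  automorphism op f -> aut_orbit op (map_tuple f x) = aut_orbit op x.
Proof.
move=> af; apply/seteqP; split=> _ [g ag <-].
  exists (g \o f); first exact: automorphism_comp.
  by apply: val_inj; rewrite /= map_comp.
have [h [ah fK _]] := automorphism_inv af.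
exists (g \o h); first exact: automorphism_comp.
apply: val_inj; rewrite /= -map_comp; apply: eq_map => y /=.
by rewrite fK.
Qed.

(** Orbits are replaced by a finite colouring that may be finer than the orbit partition; unlike
    sets of orbits, colourings pull back along maps of tuples. *)
Lemma finitely_many_orbitsP n : finitely_many_orbits op n <->
  exists N (c : n.-tuple V -> 'I_N), forall x y, c x = c y ->
    exists2 f, automorphism op f & map_tuple f x = y.
Proof.
split=> [/finite_seqP[s sE]|[N [c cP]]].
  have in_s x : aut_orbit op x \in s.
    suff: [set` s]%classic (aut_orbit op x) by [].
    by rewrite -sE; exists x.
  have lt_s x : (index (aut_orbit op x) s < size s)%N by rewrite index_mem.
  exists (size s), (fun x : n.-tuple V => Ordinal (lt_s x)) => x y [] eq_i.
  have: aut_orbit op x = aut_orbit op y.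
    by rewrite -(nth_index set0 (in_s x)) eq_i nth_index.
  move=> /seteqP[_ /(_ y)]; apply; exists id; first exact: automorphism_id.
  by apply: val_inj; rewrite /= map_id.
(* [h i] is the union of the orbits of tuples of colour [i]: a single orbit, or empty if the colour
   does not occur. *)
pose h (i : 'I_N) : set (n.-tuple V) :=
  fun z => exists2 x, c x = i & aut_orbit op x z.
apply: (@sub_finite_set _ _ (range h)); last first.
  by apply: finite_image; exact: finite_finset.
move=> _ [x _ <-]; exists (c x) => //; apply/seteqP; split=> z.
  by case=> y /esym/cP[f af <-]; rewrite aut_orbit_eq.
by move=> zx; exists x.
Qed.

End Orbits.

(* For a subring take [i] the inclusion, for a quotient ring take [i] a choice
   of representatives. *)
Lemma finitely_many_orbits_transfer (V W : zmodType) (op : V -> V -> V)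
    (op' : W -> W -> W) (i : W -> V) n :
  (forall f, automorphism op f -> exists2 g, automorphism op' g &
     forall x y, f (i x) = i y -> g x = y) ->
  finitely_many_orbits op n -> finitely_many_orbits op' n.
Proof.
move=> fg /finitely_many_orbitsP[N [c cP]]; apply/finitely_many_orbitsP.
exists N, (fun x => c (map_tuple i x)) => x y /cP[f /fg[g ag gE] fxy].
exists g => //; apply: eq_from_tnth => k; rewrite tnth_map; apply: gE.
by have := congr1 (@tnth _ _ ^~ k) fxy; rewrite !tnth_map.
Qed.

(** * Uniform bounds on additive exponent and nil index *)

Section BoundedExponents.
Variables (V : zmodType) (op : V -> V -> V).

(* A pair [(x, k x)] and a pair [(x, l x)] in the same orbit are equal. *)
Lemma orbits_bounded_exponent : finitely_many_orbits op 2 ->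
  exists2 n, (0 < n)%N & forall x : V, x *+ n = 0.
Proof.
move=> /finitely_many_orbitsP[N [c cP]]; exists N`!; first exact: fact_gt0.
(* Pigeonhole: [N.+1] multiples of [x] against [N] colours. *)
move=> x; pose d (k : 'I_N.+1) := c [tuple x; x *+ k].
have /injectivePn[k [l neq_kl dkl]] : ~~ injectiveb d.
  by apply/negP => /injectiveP/leq_card; rewrite !card_ord ltnn.
wlog lt_kl : k l neq_kl dkl / (k < l)%N => [W|].
  case: (ltngtP k l) => [|lt_lk|/val_inj]; first exact: W.
    by apply: (W l k) => //; rewrite eq_sym.
  by move/eqP; rewrite (negPf neq_kl).
have [f af /(congr1 val)/= [fx fkx]] := cP _ _ dkl.
have xd : x *+ (l - k) = 0.
  rewrite mulrnBr; last exact: ltnW.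
  by rewrite -fkx (automorphismMn _ _ af) fx subrr.
(* The difference depends on [x] but lies between 1 and [N], so the factorial serves all [x] at
   once. *)
have /dvdnP[m ->] : (l - k %| N`!)%N.
  apply: dvdn_fact; rewrite subn_gt0 lt_kl /=.
  exact: leq_trans (leq_subr _ _) (leq_ord l).
by rewrite mulnC mulrnA xd mul0rn.
Qed.

(** Automorphisms preserve the vanishing of powers, so one exponent serves each colour. The maximum
    over the colours serves everywhere, as a power that is 0 stays 0 under further
    multiplication. *)
Lemma orbits_bounded_nil_index :
    (forall x, op x 0 = 0) -> finitely_many_orbits op 1 -> is_nil op ->
  exists m, forall x, iter m (op x) x = 0.
Proof.
move=> op0 /finitely_many_orbitsP[N [c cP]] nilV.
have /choice[k kP] : forall i : 'I_N, exists k, forall x, c [tuple x] = i ->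
    iter k (op x) x = 0.
  move=> i; have [[x0 x0i]|nox] := pselect (exists x, c [tuple x] = i).
    have [k k0] := nilV x0; exists k => x; rewrite -x0i => /esym/cP[f af].
    move/(congr1 val)=> [<-].
    by rewrite -(automorphism_iter _ _ af) k0 (automorphism0 af).
  (* A colour that does not occur gets a dummy exponent. *)
  by exists 0%N => x xi; case: nox; exists x.
exists (\max_i k i) => x.
rewrite -(subnK (leq_bigmax (c [tuple x]))) iterD kP //.
by elim: (_ - _)%N => //= j ->.
Qed.

Lemma is_nilpotentP : is_nilpotent op <->
  exists k, forall x s, size s = k -> foldl op x s = 0.
Proof.
split=> -[k kP]; exists k => x s; last by rewrite kP ?size_tuple.
by move=> /eqP sk; exact: (kP x (Tuple sk)).
Qed.

End BoundedExponents.

Section Morphisms.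
Variables (V W : Type) (op : V -> V -> V) (op' : W -> W -> W) (h : V -> W).
Hypothesis hM : {morph h : x y / op x y >-> op' x y}.

Lemma morph_iter k x : h (iter k (op x) x) = iter k (op' (h x)) (h x).
Proof. by elim: k => //= k IH; rewrite hM IH. Qed.

Lemma morph_foldl x s : h (foldl op x s) = foldl op' (h x) (map h s).
Proof. by elim: s x => //= y s IH x; rewrite IH hM. Qed.

End Morphisms.

(** * Non-unital rings, ideals, and extensions of nilpotent rings *)

Section RingTheory.
Variable R : assocRing.
Local Notation "x ** y" := (ring_mul x y) (at level 40, left associativity).

Lemma ring_mul0l x : 0 ** x = 0 :> R.
Proof. by apply: (addIr (0 ** x)); rewrite -ring_mulDl !add0r. Qed.

Lemma ring_mul0r x : x ** 0 = 0 :> R.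
Proof. by apply: (addIr (x ** 0)); rewrite -ring_mulDr !add0r. Qed.

Lemma ring_mulNl x y : (- x) ** y = - (x ** y) :> R.
Proof. by apply: (addIr (x ** y)); rewrite -ring_mulDl !addNr ring_mul0l. Qed.

Lemma ring_mulNr x y : x ** (- y) = - (x ** y) :> R.
Proof. by apply: (addIr (x ** y)); rewrite -ring_mulDr !addNr ring_mul0r. Qed.

Lemma ring_mulBl x y z : (x - y) ** z = x ** z - y ** z :> R.
Proof. by rewrite ring_mulDl ring_mulNl. Qed.

Lemma ring_mulBr x y z : z ** (x - y) = z ** x - z ** y :> R.
Proof. by rewrite ring_mulDr ring_mulNr. Qed.

Lemma ring_mulnl x y n : (x *+ n) ** y = (x ** y) *+ n :> R.
Proof.
elim: n => [|n IH]; first by rewrite !mulr0n ring_mul0l.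
by rewrite !mulrS ring_mulDl IH.
Qed.

Lemma ring_mulnr x y n : x ** (y *+ n) = (x ** y) *+ n :> R.
Proof.
elim: n => [|n IH]; first by rewrite !mulr0n ring_mul0r.
by rewrite !mulrS ring_mulDr IH.
Qed.

Lemma ring_mul_foldl x y (s : seq R) :
  x ** foldl (@ring_mul R) y s = foldl (@ring_mul R) (x ** y) s.
Proof. by elim: s y => //= z s IH y; rewrite IH ring_mulA. Qed.

Definition ring_commutator (x y : R) : R := x ** y - y ** x.

Record two_sided_ideal (I : R -> Prop) : Prop := TwoSidedIdeal {
  ideal0 : I 0;
  idealB : forall x y, I x -> I y -> I (x - y);
  ideal_mull : forall a x, I x -> I (a ** x);
  ideal_mulr : forall a x, I x -> I (x ** a) }.

Definition characteristic (S : R -> Prop) : Prop :=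
  forall f, automorphism (@ring_mul R) f -> forall x, S x -> S (f x).

(* Group the factors after the first into [k] blocks of length [m.+1]; the
   product of each block lies in [I]. *)
Lemma nilpotent_extension (I : R -> Prop) m k :
  (forall x s, size s = m -> I (foldl (@ring_mul R) x s)) ->
  (forall x s, {in s, forall y, I y} -> size s = k ->
     foldl (@ring_mul R) x s = 0) ->
  is_nilpotent (@ring_mul R).
Proof.
move=> quoI nilI; apply/is_nilpotentP; exists (k * m.+1)%N.
have blocks j x s : size s = (j * m.+1)%N -> exists t,
    [/\ size t = j, {in t, forall y, I y}
      & foldl (@ring_mul R) x s = foldl (@ring_mul R) x t].
  elim: j x s => [|j IH] x s.
    by rewrite mul0n => /size0nil->; exists [::].
  rewrite mulSn => szs.
  have: size (take m.+1 s) = m.+1 by rewrite size_takel // szs leq_addr.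
  have: size (drop m.+1 s) = (j * m.+1)%N by rewrite size_drop szs addKn.
  rewrite -{3}(cat_take_drop m.+1 s); move: (take _ _) (drop _ _) => s1 s2.
  move=> /IH sz2; case: s1 => // b s1 [sz1].
  (* By associativity the first block collapses to one factor, the product of [b :: s1], which
     becomes the head of the new list. *)
  have [t [szt It tE]] := sz2 (x ** foldl (@ring_mul R) b s1).
  exists (foldl (@ring_mul R) b s1 :: t); split=> /=; first by rewrite szt.
    by move=> y; rewrite inE => /predU1P[->|/It//]; exact: quoI.
  by rewrite foldl_cat /= -ring_mul_foldl tE.
by move=> x s /(blocks _ x)[t [szt It ->]]; exact: nilI.
Qed.

End RingTheory.

(** * Subrings and their inheritance properties *)

Section Subring.
Variables (R : assocRing) (S : R -> Prop).
Hypotheses (S0 : S 0) (SB : forall x y, S x -> S y -> S (x - y)).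
Hypothesis SM : forall x y, S x -> S y -> S (ring_mul x y).

Definition subring_pred : {pred R} := fun x => `[< S x >].

Lemma subring_predP x : reflect (S x) (x \in subring_pred).
Proof. exact: asboolP. Qed.

Fact subring_pred_closed : zmod_closed subring_pred.
Proof.
split; first exact/subring_predP.
by move=> x y /subring_predP Sx /subring_predP Sy; apply/subring_predP; exact: SB.
Qed.

HB.instance Definition _ :=
  GRing.isZmodClosed.Build R subring_pred subring_pred_closed.

Definition subring_sort := {x : R | x \in subring_pred}.
HB.instance Definition _ := SubChoice.on subring_sort.
HB.instance Definition _ := [SubChoice_isSubZmodule of subring_sort by <:].

Fact subring_mul_subproof (x y : subring_sort) :
  ring_mul (val x) (val y) \in subring_pred.
Proof. by apply/subring_predP; apply: SM; exact/subring_predP/valP. Qed.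

Definition subring_mul (x y : subring_sort) : subring_sort :=
  Sub (ring_mul (val x) (val y)) (subring_mul_subproof x y).

Fact subring_mulA : associative subring_mul.
Proof. by move=> x y z; apply: val_inj; exact: ring_mulA. Qed.

Fact subring_mulDl : left_distributive subring_mul +%R.
Proof. by move=> x y z; apply: val_inj; exact: ring_mulDl. Qed.

Fact subring_mulDr : right_distributive subring_mul +%R.
Proof. by move=> x y z; apply: val_inj; exact: ring_mulDr. Qed.

Definition subring := AssocRing subring_mulA subring_mulDl subring_mulDr.

Lemma subring_val_foldl (x : subring) (s : seq subring) :
  val (foldl (@ring_mul subring) x s) = foldl (@ring_mul R) (val x) (map val s).
Proof. exact: morph_foldl. Qed.

Lemma subring_nil : is_nil (@ring_mul R) -> is_nil (@ring_mul subring).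
Proof.
move=> nilR x; have [k k0] := nilR (val x); exists k; apply: val_inj.
by rewrite -[RHS]k0; exact: morph_iter.
Qed.

Definition to_subring (x : R) : subring := insubd (0 : subring_sort) x.

Lemma to_subringK x : S x -> val (to_subring x) = x.
Proof. by move=> Sx; rewrite insubdK //; apply/subring_predP. Qed.

Lemma subring_valP (x : subring) : S (val x).
Proof. exact/subring_predP/(valP x). Qed.

(** An automorphism of [R] and its inverse both preserve [S], so they restrict to mutually inverse
    automorphisms of the subring. *)
Lemma subring_orbits n : characteristic S ->
  finitely_many_orbits (@ring_mul R) n ->
  finitely_many_orbits (@ring_mul subring) n.
Proof.
move=> charS; apply: (finitely_many_orbits_transfer (i := val)) => f af.
have [g [ag fK gK]] := automorphism_inv af.
have valK h : automorphism (@ring_mul R) h ->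
    forall x : subring, val (to_subring (h (val x))) = h (val x).
  by move=> ah x; apply: to_subringK; apply: charS => //; exact: subring_valP.
exists (fun x : subring => to_subring (f (val x))); last first.
  by move=> x y fxy; apply: val_inj; rewrite valK.
split.
- by exists (fun x : subring => to_subring (g (val x))) => x;
    apply: val_inj; rewrite valK // valK // ?fK ?gK.
- by move=> x y; apply: val_inj; rewrite valK // (automorphismD af) /= !valK.
- by move=> x y; apply: val_inj; rewrite valK // (automorphismM af) /= !valK.
Qed.

(* The extra factor absorbs a leading coordinate outside [S]. *)
Lemma subring_nilpotent : is_nilpotent (@ring_mul subring) ->
  exists k, forall x s, {in s, forall y, S y} -> size s = k ->
    foldl (@ring_mul R) x s = 0.
Proof.
move=> /is_nilpotentP[k kP]; exists k.+1 => x [//|y s] Ss [szs] /=.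
rewrite -ring_mul_foldl -[y]to_subringK; last by apply: Ss; rewrite mem_head.
have -> : s = map val (map to_subring s).
  rewrite -map_comp -[LHS]map_id; apply/eq_in_map => z zs /=.
  by rewrite to_subringK //; apply: Ss; rewrite inE zs orbT.
by rewrite -subring_val_foldl kP ?size_map // ring_mul0r.
Qed.

End Subring.

(** * Quotients by two-sided ideals *)

Section Quotient.
Variables (R : assocRing) (I : R -> Prop) (idealI : two_sided_ideal I).

Definition ideal_pred : {pred R} := fun x => `[< I x >].

Fact ideal_pred_closed : zmod_closed ideal_pred.
Proof.
split; first exact/asboolP/(ideal0 idealI).
by move=> x y /asboolP Ix /asboolP Iy; apply/asboolP; exact: (idealB idealI).
Qed.

HB.instance Definition _ :=
  GRing.isZmodClosed.Build R ideal_pred ideal_pred_closed.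

Definition quotient_sort : zmodType := Quotient.quot ideal_pred.

Definition to_quotient (x : R) : quotient_sort :=
  \pi_(Quotient.quot ideal_pred)%qT x.

Definition of_quotient (x : quotient_sort) : R :=
  repr (x : Quotient.quot ideal_pred).

Lemma of_quotientK : cancel of_quotient to_quotient.
Proof. exact: reprK. Qed.

Lemma to_quotientP x y : to_quotient x = to_quotient y <-> I (x - y).
Proof.
split=> [/eqP|Ixy]; last apply/eqP; rewrite /to_quotient -Quotient.idealrBE.
  by move/asboolP.
exact/asboolP.
Qed.

Lemma to_quotient0P x : to_quotient x = 0 <-> I x.
Proof.
have -> : 0 = to_quotient 0 by rewrite /to_quotient raddf0.
by rewrite to_quotientP subr0.
Qed.

Lemma to_quotientD : {morph to_quotient : x y / x + y}.
Proof. exact: raddfD. Qed.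

Definition quotient_mul (x y : quotient_sort) : quotient_sort :=
  to_quotient (ring_mul (of_quotient x) (of_quotient y)).

Lemma to_quotientM :
  {morph to_quotient : x y / ring_mul x y >-> quotient_mul x y}.
Proof.
move=> x y; apply/to_quotientP; set x' := of_quotient _; set y' := of_quotient _.
have Ix : I (x - x') by apply/to_quotientP; rewrite of_quotientK.
have Iy : I (y' - y) by apply/to_quotientP; rewrite of_quotientK.
have -> : ring_mul x y - ring_mul x' y' =
    ring_mul (x - x') y - ring_mul x' (y' - y).
  by rewrite ring_mulBl ring_mulBr opprB addrA addrNK.
by apply: (idealB idealI); [apply: (ideal_mulr idealI)|apply: (ideal_mull idealI)].
Qed.

Lemma quotient_ind (P : quotient_sort -> Prop) :
  (forall x, P (to_quotient x)) -> forall x, P x.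
Proof. by move=> Pq x; rewrite -[x]of_quotientK. Qed.

Fact quotient_mulA : associative quotient_mul.
Proof.
elim/quotient_ind => x; elim/quotient_ind => y; elim/quotient_ind => z.
by rewrite -!to_quotientM ring_mulA.
Qed.

Fact quotient_mulDl : left_distributive quotient_mul +%R.
Proof.
elim/quotient_ind => x; elim/quotient_ind => y; elim/quotient_ind => z.
by rewrite -to_quotientD -!to_quotientM -to_quotientD ring_mulDl.
Qed.

Fact quotient_mulDr : right_distributive quotient_mul +%R.
Proof.
elim/quotient_ind => x; elim/quotient_ind => y; elim/quotient_ind => z.
by rewrite -to_quotientD -!to_quotientM -to_quotientD ring_mulDr.
Qed.

Definition quotient := AssocRing quotient_mulA quotient_mulDl quotient_mulDr.

Lemma quotient_nil : is_nil (@ring_mul R) -> is_nil (@ring_mul quotient).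
Proof.
move=> nilR; elim/quotient_ind => x; have [k k0] := nilR x; exists k.
rewrite -(morph_iter to_quotientM) k0; apply/to_quotient0P; exact: (ideal0 idealI).
Qed.

Lemma quotient_countable : countable [set: R] -> countable [set: quotient].
Proof.
move=> /countable_injP[g /in2TT g_inj]; apply/countable_injP.
exists (g \o of_quotient); apply: in2W => x y /g_inj.
exact: (can_inj of_quotientK).
Qed.

Lemma quotient_orbits n : characteristic I ->
  finitely_many_orbits (@ring_mul R) n ->
  finitely_many_orbits (@ring_mul quotient) n.
Proof.
move=> charI.
apply: (finitely_many_orbits_transfer (i := of_quotient)) => f af.
have [g [ag fK gK]] := automorphism_inv af.
(* Since [h] preserves [I], the class of [h x] depends only on the class of [x]; hence automorphisms
   descend to the quotient. *)
have toK h x : automorphism (@ring_mul R) h ->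
    to_quotient (h (of_quotient (to_quotient x))) = to_quotient (h x).
  move=> ah; apply/to_quotientP.
  rewrite -(automorphismN _ ah) -(automorphismD ah); apply: charI => //.
  by apply/to_quotientP; rewrite of_quotientK.
exists (fun x => to_quotient (f (of_quotient x))); last first.
  by move=> x y ->; rewrite of_quotientK.
split.
- exists (fun x => to_quotient (g (of_quotient x))) => x;
    by rewrite toK // ?fK ?gK of_quotientK.
- elim/quotient_ind => x; elim/quotient_ind => y.
  by rewrite -to_quotientD !toK // (automorphismD af) to_quotientD.
- elim/quotient_ind => x; elim/quotient_ind => y.
  by rewrite /= -to_quotientM !toK // (automorphismM af) to_quotientM.
Qed.

Lemma quotient_nilpotent : is_nilpotent (@ring_mul quotient) ->
  exists m, forall x s, size s = m -> I (foldl (@ring_mul R) x s).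
Proof.
move=> /is_nilpotentP[m mP]; exists m => x s szs; apply/to_quotient0P.
by rewrite (morph_foldl to_quotientM) mP ?size_map.
Qed.

End Quotient.

(** * The center and the ideal it generates *)

Section Center.
Variable R : assocRing.
Local Notation "x ** y" := (ring_mul x y) (at level 40, left associativity).

Definition central (z : R) : Prop := forall x, z ** x = x ** z.

(** The smallest two-sided ideal containing the center. The inductive form allows induction on the
    generation of an element, with no normal form for sums of products. *)
Inductive central_ideal : R -> Prop :=
| CentralIdealIn z of central z : central_ideal z
| CentralIdealB x y of central_ideal x & central_ideal y : central_ideal (x - y)
| CentralIdealMl a x of central_ideal x : central_ideal (a ** x)
| CentralIdealMr a x of central_ideal x : central_ideal (x ** a).

Lemma central0 : central 0.
Proof. by move=> x; rewrite ring_mul0l ring_mul0r. Qed.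

Lemma centralB x y : central x -> central y -> central (x - y).
Proof. by move=> cx cy a; rewrite ring_mulBl ring_mulBr cx cy. Qed.

Lemma centralM x y : central x -> central y -> central (x ** y).
Proof. by move=> cx cy a; rewrite -ring_mulA cy ring_mulA cx ring_mulA. Qed.

Lemma central_characteristic : characteristic central.
Proof.
move=> f af z cz x; have [g [_ _ gK]] := automorphism_inv af.
by rewrite -[x]gK -!(automorphismM af) cz.
Qed.

Lemma central_ideal_two_sided : two_sided_ideal central_ideal.
Proof.
split; [exact: CentralIdealIn central0|exact: CentralIdealB|..].
  exact: CentralIdealMl.
exact: CentralIdealMr.
Qed.

Lemma central_ideal_characteristic : characteristic central_ideal.
Proof.
move=> f af x; elim=> [z cz|{}x y _ fx _ fy|a {}x _ fx|a {}x _ fx].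
- exact/CentralIdealIn/central_characteristic.
- rewrite (automorphismD af) (automorphismN _ af); exact: CentralIdealB.
- by rewrite (automorphismM af); exact: CentralIdealMl.
- by rewrite (automorphismM af); exact: CentralIdealMr.
Qed.

Lemma foldl_mulB x y s : foldl (@ring_mul R) (x - y) s =
  foldl (@ring_mul R) x s - foldl (@ring_mul R) y s.
Proof. by elim: s x y => //= z s IH x y; rewrite ring_mulBl IH. Qed.

Lemma foldl_mul_central x a s : {in s, forall z, central z} ->
  foldl (@ring_mul R) (x ** a) s = foldl (@ring_mul R) x s ** a.
Proof.
elim: s x => //= z s IH x cs.
rewrite -ring_mulA -(cs z) ?mem_head // ring_mulA IH // => y ys.
by apply: cs; rewrite inE ys orbT.
Qed.

(** The left annihilator of [Z^j], where [Z] is the center; for [j = 0] it is zero. *)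
Definition center_power_annihilator j (x : R) : Prop :=
  forall s, {in s, forall z, central z} -> size s = j ->
    foldl (@ring_mul R) x s = 0.

(** Induction on the generation of [y], with [x] varying. A central [y] is one more central factor;
    for [a ** y], the factor [a] is moved onto [x], and [x ** a] is still annihilated because [a]
    commutes past central factors. *)
Lemma annihilator_mul_central_ideal j x y : central_ideal y ->
  center_power_annihilator j.+1 x -> center_power_annihilator j (x ** y).
Proof.
move=> Iy.
elim: Iy x => {y} [z cz|y z _ IHy _ IHz|a y _ IHy|a y _ IHy] x Ax s cs szs.
- apply: (Ax (z :: s)) => /=; last by rewrite szs.
  by move=> u; rewrite inE => /predU1P[->//|/cs].
- by rewrite ring_mulBr foldl_mulB IHy // IHz // subr0.
- rewrite ring_mulA IHy // => t ct szt.
  by rewrite foldl_mul_central // Ax // ring_mul0l.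
- by rewrite ring_mulA foldl_mul_central // IHy // ring_mul0l.
Qed.

(** Each factor from the ideal lowers by one the power of the center that kills the partial product.
    After [k] factors the power is 0, so the product itself vanishes. *)
Lemma central_ideal_nilpotent k :
  (forall x s, {in s, forall z, central z} -> size s = k ->
     foldl (@ring_mul R) x s = 0) ->
  forall x s, {in s, forall y, central_ideal y} -> size s = k ->
    foldl (@ring_mul R) x s = 0.
Proof.
move=> nilZ x s Is szs; have: center_power_annihilator (size s) x.
  by rewrite szs => t; exact: nilZ.
elim: s x Is {szs} => [|y s IH] x Is Ax /=; first exact: (Ax [::]).
apply: IH; first by move=> z zs; apply: Is; rewrite inE zs orbT.
by apply: annihilator_mul_central_ideal => //; apply: Is; rewrite mem_head.
Qed.

End Center.

(** Induction on [c]: Cherlin's theorem handles the center, the induction hypothesis the quotient by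
    the ideal it generates, and [nilpotent_extension] joins the two. *)
Lemma nil_lie_nilpotent_ring (c : nat) (R : assocRing) : cherlin_theorem_I ->
  is_nil (@ring_mul R) -> finitely_many_orbits (@ring_mul R) 3 ->
  (forall x s, size s = c -> foldl (@ring_commutator R) x s = 0) ->
  is_nilpotent (@ring_mul R).
Proof.
move=> cherlin; elim: c R => [|c IH] R nilR orbR lieR.
  (* With no brackets at all, the hypothesis says that every [x] is 0. *)
  by exists 0%N => x s; rewrite tuple0; exact: (lieR x [::]).
pose Z := subring (@central0 R) (@centralB R) (@centralM R).
have nilZ : is_nilpotent (@ring_mul Z).
  apply: cherlin; last exact: subring_orbits (@central_characteristic R) orbR.
    by move=> x y; apply: val_inj; exact: (subring_valP x (val y)).
  exact: subring_nil.
have [k kP] := subring_nilpotent nilZ.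
pose idealI := central_ideal_two_sided R; pose Q := quotient idealI.
have nilQ : is_nilpotent (@ring_mul Q).
  apply: IH; first exact: quotient_nil.
    exact: quotient_orbits (@central_ideal_characteristic R) orbR.
  move=> x s szs.
  have qC : {morph to_quotient idealI : x y /
      ring_commutator x y >-> @ring_commutator Q x y}.
    by move=> u v; rewrite /ring_commutator /= -!to_quotientM /to_quotient raddfB.
  (* Lifted to [R], a commutator with [c] brackets is central, because one further bracket with any
     [y] gives 0; so it dies in [Q]. *)
  rewrite -[x]of_quotientK -(mapK (@of_quotientK _ _ idealI) s).
  rewrite -(morph_foldl qC); apply/to_quotient0P/CentralIdealIn => y.
  have := lieR (of_quotient x) (rcons (map (@of_quotient _ _ idealI) s) y).
  by rewrite foldl_rcons size_rcons size_map szs => /(_ erefl)/subr0_eq.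
have [m mP] := quotient_nilpotent nilQ.
exact: (nilpotent_extension mP (central_ideal_nilpotent kP)).
Qed.

(** * Associative algebras and their Lie algebras *)

Section AlgebraAsRing.
Variables (K : fieldType) (A : assocAlg K).

Fact alg_mulDl : left_distributive (@alg_mul K A) +%R.
Proof. by move=> x y z; have := alg_linearl z 1 x y; rewrite !scale1r. Qed.

Fact alg_mulDr : right_distributive (@alg_mul K A) +%R.
Proof. by move=> z x y; have := alg_linearr z 1 x y; rewrite !scale1r. Qed.

Definition alg_ring : assocRing :=
  AssocRing (@alg_mulA K A) alg_mulDl alg_mulDr.

(** Automorphisms of [A] preserve commutators, so each orbit for [L(A)] is a union of orbits for
    [A]. *)
Lemma associated_lie_omega_categorical :
  omega_categorical (@alg_mul K A) ->
  omega_categorical (@bracket K (associated_lie A)).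
Proof.
move=> [cA oA]; split=> // n.
apply: (finitely_many_orbits_transfer (i := id)) (oA n) => f af.
exists f => //; split; [exact: automorphism_bij af|exact: automorphismD af|].
move=> x y; rewrite /= /commutator (automorphismD af) (automorphismN _ af).
by rewrite !(automorphismM af).
Qed.

(* The commuting left and right multiplications by [y] are nilpotent of index
   [m.+1], so their difference is nilpotent of index [2 m + 1]. *)
Lemma nil_engel m : (forall x, iter m (@alg_mul K A x) x = 0) ->
  engel (associated_lie A) m.*2.+1.
Proof.
move=> nilA x y.
pose L := @alg_mul K A y; pose R := (@alg_mul K A)^~ y.
have LB u v : L (u - v) = L u - L v by exact: alg_mulBr.
have RB u v : R (u - v) = R u - R v by exact: alg_mulBl.
have LR u : L (R u) = R (L u) by exact: alg_mulA.
have iterB (h : A -> A) k : {morph h : u v / u - v} ->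
    {morph iter k h : u v / u - v}.
  by move=> hB u v; elim: k => //= k ->; rewrite hB.
(* [iter k L y] is the power [y^(k+1)], whence the shift of index. *)
have iterL k u : iter k.+1 L u = alg_mul (iter k L y) u.
  by elim: k => //= k; rewrite /L => ->; rewrite alg_mulA.
have LyR k : R (iter k L y) = iter k.+1 L y.
  by elim: k => //= k; rewrite -LR => ->.
have iterR k u : iter k.+1 R u = alg_mul u (iter k L y).
  by elim: k => //= k ->; rewrite /R -alg_mulA -[alg_mul _ y]/(R _) LyR.
have zero0 (h : A -> A) k : {morph h : u v / u - v} -> iter k h 0 = 0.
  by move=> hB; rewrite -[in LHS](subrr 0) iterB // subrr.
have mul0A u : alg_mul 0 u = 0 :> A := @ring_mul0l alg_ring u.
have mulA0 u : alg_mul u 0 = 0 :> A := @ring_mul0r alg_ring u.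
have L0 i u : (m < i)%N -> iter i L u = 0.
  move=> /subnK<-; rewrite iterD iterL nilA.
  by rewrite mul0A zero0.
have R0 i u : (m < i)%N -> iter i R u = 0.
  move=> /subnK<-; rewrite iterD iterR nilA.
  by rewrite mulA0 zero0.
(* The sum [n + i + j] counts all multiplications by [y]. Unfolding one commutator as [R - L] lowers
   [n] and raises [j] or [i], keeping the sum. *)
have main n i j u : (m.*2 < n + i + j)%N ->
    iter i L (iter j R (iter n (fun z => commutator z y) u)) = 0.
  elim: n i j => [|n IH] i j lt_m.
    (* As [i + j] exceeds [2 m], one of [i] and [j] exceeds [m]. *)
    have [/L0->//|le_im] := ltnP m i.
    rewrite R0 ?zero0 // -(ltn_add2l m) addnn (leq_trans lt_m) //.
    by rewrite add0n leq_add2r.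
  rewrite iterS {1}/commutator -/(R _) -/(L _) !iterB //.
  have -> v : iter j R (L v) = L (iter j R v).
    by elim: j {lt_m} => //= j ->.
  by rewrite -!iterSr !IH ?subrr //; rewrite !(addSn, addnS) in lt_m *.
by have := main m.*2.+1 0%N 0%N x; rewrite !addn0; apply.
Qed.

(** Appending an entry on the right moves a left-normed commutator one step down the lower central
    series. *)
Lemma lie_nilpotent_foldl : lie_nilpotent (associated_lie A) ->
  exists c, forall x s, size s = c -> foldl (@commutator K A) x s = 0.
Proof.
move=> [c lc0]; exists c => x s szs.
have : @lower_central K (associated_lie A) (size s)
    (foldl (@commutator K A) x s).
  elim/last_ind: s {szs} => [//|s y IH].
  rewrite foldl_rcons size_rcons => W [_ subW]; apply: subW.
  by exists (foldl (@commutator K A) x s) => //; exists y.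
by rewrite szs lc0.
Qed.

(** Statement (1) over an arbitrary field: the ring underlying [A] has the same commutators as
    [L(A)]. *)
Lemma nil_lie_nilpotent_algebra : cherlin_theorem_I ->
  omega_categorical (@alg_mul K A) -> is_nil (@alg_mul K A) ->
  lie_nilpotent (associated_lie A) -> is_nilpotent (@alg_mul K A).
Proof.
move=> cherlin [_ oA] nilA /lie_nilpotent_foldl[c lieA].
exact: (@nil_lie_nilpotent_ring c alg_ring).
Qed.

End AlgebraAsRing.

(** * Rings of prime exponent as algebras over the prime field *)

Section PrimeExponent.
Variables (R : assocRing) (p : nat).
Hypotheses (p_pr : prime p) (pR : forall x : R, x *+ p = 0).

Definition Fp_scale (a : 'F_p) (x : R) : R := x *+ a.

Lemma mulrn_modp (x : R) n : x *+ (n %% p) = x *+ n.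
Proof. by rewrite [in RHS](divn_eq n p) mulrnDr mulnC mulrnA pR mul0rn add0r. Qed.

(** As [p] kills [R], any natural representative of a scalar may be used; the module axioms thus
    reduce to laws of natural multiples. *)
Lemma Fp_scale_nat n x : Fp_scale n%:R x = x *+ n.
Proof. by rewrite /Fp_scale val_Fp_nat // mulrn_modp. Qed.

Fact Fp_scaleA a b x : Fp_scale a (Fp_scale b x) = Fp_scale (a * b) x.
Proof.
by rewrite -[a]natr_Zp -[b]natr_Zp -natrM !Fp_scale_nat mulnC mulrnA.
Qed.

Fact Fp_scale1 : left_id 1 Fp_scale.
Proof. by move=> x; rewrite (Fp_scale_nat 1). Qed.

Fact Fp_scaleDr : right_distributive Fp_scale +%R.
Proof. by move=> a x y; rewrite /Fp_scale mulrnDl. Qed.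

Fact Fp_scaleDl x : {morph Fp_scale^~ x : a b / a + b}.
Proof.
move=> a b; rewrite -[a]natr_Zp -[b]natr_Zp -natrD !Fp_scale_nat.
exact: mulrnDr.
Qed.

(* The proofs are parameters so that only this alias carries the scaling. *)
Definition Fp_module of prime p & (forall x : R, x *+ p = 0) : Type := R.
Local Notation M := (Fp_module p_pr pR).

HB.instance Definition _ := GRing.Zmodule.copy M R.
HB.instance Definition _ := GRing.Zmodule_isLmodule.Build 'F_p M
  Fp_scaleA Fp_scale1 Fp_scaleDr Fp_scaleDl.

Fact Fp_linearl (y : M) : linear ((@ring_mul R)^~ y : M -> M).
Proof. by move=> a u v; rewrite ring_mulDl ring_mulnl. Qed.

Fact Fp_linearr (x : M) : linear (@ring_mul R x : M -> M).
Proof. by move=> a u v; rewrite ring_mulDr ring_mulnr. Qed.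

Definition Fp_algebra : assocAlg 'F_p :=
  @AssocAlg 'F_p M (@ring_mul R) (@ring_mulA R) Fp_linearl Fp_linearr.

Lemma Fp_algebra_omega_categorical :
  omega_categorical (@ring_mul R) -> omega_categorical (@alg_mul _ Fp_algebra).
Proof.
move=> [cR oR]; split=> // n.
apply: (@finitely_many_orbits_transfer R M (@ring_mul R) (@ring_mul R) id) (oR n).
by move=> f [bf Df Mf]; exists f.
Qed.

Lemma nil_prime_exponent_nilpotent : cherlin_theorem_I -> WCLA ->
  omega_categorical (@ring_mul R) -> is_nil (@ring_mul R) ->
  is_nilpotent (@ring_mul R).
Proof.
move=> cherlin wcla oR nilR.
have oA := Fp_algebra_omega_categorical oR.
have [m mP] := orbits_bounded_nil_index (@ring_mul0r R) (oR.2 1%N) nilR.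
have lieA := wcla p m.*2.+1 p_pr isT _ (associated_lie_omega_categorical oA)
  (@nil_engel _ Fp_algebra m mP).
exact: (@nil_lie_nilpotent_algebra _ Fp_algebra).
Qed.

End PrimeExponent.

(** * Reduction of an arbitrary exponent to prime exponents *)

Section Multiples.
Variables (R : assocRing) (p : nat).

Definition multiple (x : R) : Prop := exists y : R, x = y *+ p.

Lemma multiple_two_sided : two_sided_ideal multiple.
Proof.
split; first by exists 0; rewrite mul0rn.
- by move=> _ _ [u ->] [v ->]; exists (u - v); rewrite mulrnBl.
- by move=> a _ [u ->]; exists (ring_mul a u); rewrite ring_mulnr.
- by move=> a _ [u ->]; exists (ring_mul u a); rewrite ring_mulnl.
Qed.

Lemma multiple_characteristic : characteristic multiple.
Proof.
by move=> f af _ [u ->]; exists (f u); rewrite (automorphismMn _ _ af).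
Qed.

End Multiples.

(** Strong induction on [n]: for a prime divisor [p], the quotient [R / pR] has exponent [p], while
    [pR] is killed by [n / p]. *)
Lemma nil_exponent_nilpotent n (R : assocRing) : cherlin_theorem_I -> WCLA ->
  (0 < n)%N -> (forall x : R, x *+ n = 0) ->
  omega_categorical (@ring_mul R) -> is_nil (@ring_mul R) ->
  is_nilpotent (@ring_mul R).
Proof.
move=> cherlin wcla; have [b] := ubnP n.
elim: b n R => // b IH n R lt_nb n_gt0 nR [cR oR] nilR.
have [n_le1|n_gt1] := leqP n 1.
  have n1 : n = 1%N by apply/eqP; rewrite eqn_leq n_le1.
  (* Exponent 1 forces [R] to be zero. *)
  by exists 0%N => x s; rewrite -[LHS]mulr1n -n1.
pose p := pdiv n; have p_pr : prime p := pdiv_prime n_gt1.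
pose idealI := multiple_two_sided R p.
have charI := @multiple_characteristic R p.
have IM (x y : R) : multiple p x -> multiple p y -> multiple p (ring_mul x y).
  by move=> Ix _; exact: (ideal_mulr idealI).
pose S := subring (ideal0 idealI) (idealB idealI) IM.
pose Q := quotient idealI.
have nilQ : is_nilpotent (@ring_mul Q).
  apply: (nil_prime_exponent_nilpotent p_pr) => //.
  - elim/quotient_ind => x.
    rewrite /to_quotient -raddfMn; apply/to_quotient0P; by exists x.
  - split; first exact: quotient_countable.
    by move=> k; exact: quotient_orbits.
  - exact: quotient_nil.
have nilS : is_nilpotent (@ring_mul S).
  apply: (IH (n %/ p)%N).
  - exact: leq_trans (ltn_Pdiv (prime_gt1 p_pr) n_gt0) lt_nb.
  - by rewrite divn_gt0 ?prime_gt0 // dvdn_leq // pdiv_dvd.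
  - move=> x; apply: val_inj; rewrite raddfMn.
    have [y xE] := subring_valP x.
    by rewrite [X in X *+ _]xE -mulrnA mulnC divnK ?pdiv_dvd.
  - split; last by move=> k; exact: subring_orbits.
    have /countable_injP[g /in2TT g_inj] := cR; apply/countable_injP.
    by exists (g \o val); apply: in2W => x y /g_inj/val_inj.
  - exact: subring_nil.
have [m mP] := quotient_nilpotent nilQ.
have [k kP] := subring_nilpotent nilS.
exact: nilpotent_extension mP kP.
Qed.

Theorem theorem2p3 :
  cherlin_theorem_I ->
  (forall p : nat, prime p -> forall A : assocAlg 'F_p,
     omega_categorical (@alg_mul _ A) -> is_nil (@alg_mul _ A) ->
     lie_nilpotent (associated_lie A) -> is_nilpotent (@alg_mul _ A))
  /\
  (WCLA -> forall R : assocRing,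
     omega_categorical (@ring_mul R) -> is_nil (@ring_mul R) ->
     is_nilpotent (@ring_mul R)).
Proof.
move=> cherlin; split=> [p _ A|wcla R oR nilR].
  exact: nil_lie_nilpotent_algebra.
have [n n_gt0 nR] := orbits_bounded_exponent (oR.2 2%N).
exact: (nil_exponent_nilpotent cherlin wcla n_gt0 nR).
Qed.
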